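(* Let $k$ and $n$ be integers such that $n\ge 2$ and $0<k<n$. There exist two positive constants $A_{n,k}$ and $B_{n,k}$ (depending only on $n$ and $k$) such that, for all $T>0$, $a>0$, $b>0$ and all $f\in\mathcal{L}_n(a,b;[0,T])$, $$\|f^{(k)}\|_\infty\le A_{n,k}\,a\,T^{-k}+B_{n,k}\,b\,T^{n-k}.$$
   Context: $\mathcal{L}_n(a,b;[0,T])$ is the set of functions $f:[0,T]\to\mathbb{R}$ that are $(n-1)$ times differentiable on $[0,T]$ (one-sided at the endpoints), with $f^{(n-1)}$ absolutely continuous on $[0,T]$, such that $|f(t)|\le a$ for all $t\in[0,T]$ and $|f^{(n)}(t)|\le b$ for almost every $t\in[0,T]$. $\|\cdot\|_\infty$ is the essential supremum norm on $[0,T]$. *)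

(* Defs.v *)
From HB Require Import structures.
From mathcomp Require Export all_boot all_order all_algebra.
From mathcomp Require Export all_classical all_reals all_analysis.

Set Implicit Arguments.
Unset Strict Implicit.
Unset Printing Implicit Defensive.

Export Order.TTheory GRing.Theory Num.Theory.
Export numFieldNormedType.Exports.

Global Open Scope classical_set_scope.
Global Open Scope ring_scope.

(* A function [0, T] -> R is represented by f : R -> R; only the values of f  *)
(* on [0, T] matter, because all derivatives below are taken relatively to    *)
(* that set.                                                                  *)

Definition slope {R : realType} (f : R -> R) (x y : R) : R :=
  (f y - f x) / (y - x).

(* The limit is over y in A, y != x: for A = [0, T] it is the usual two-sided *)
(* derivative at interior points and the one-sided derivative at 0 and T.     *)
Definition derivable_within {R : realType} (A : set R) (f : R -> R) (x : R) :
    Prop :=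
  cvg (slope f x @ within A x^').

(* Meaningful only where derivable_within A f x holds; lim is total.          *)
Definition derive_within {R : realType} (A : set R) (f : R -> R) : R -> R :=
  fun x => lim (slope f x @ within A x^').

Definition derive_withinn {R : realType} (A : set R) (j : nat) (f : R -> R) :
    R -> R :=
  iter j (derive_within A) f.

Definition absolutely_continuous_on {R : realType} (c d : R) (g : R -> R) :
    Prop :=
  forall e : R, 0 < e -> exists2 delta : R, 0 < delta &
    forall (m : nat) (u v : 'I_m -> R),
      (forall i, c <= u i /\ u i <= v i /\ v i <= d) ->
      trivIset [set: 'I_m] (fun i => `]u i, v i[%classic) ->
      \sum_(i < m) (v i - u i) < delta ->
      \sum_(i < m) `|g (v i) - g (u i)| < e.

(* The last clause includes the existence of the n-th derivative at almost    *)
(* every t (automatic for an absolutely continuous (n-1)-st derivative), so   *)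
(* that the bound never refers to a default value of lim.                     *)
Definition class_L {R : realType} (n : nat) (a b T : R) (f : R -> R) : Prop :=
  [/\ forall j : nat, (j < n.-1)%N -> forall t : R, t \in `[0, T] ->
        derivable_within `[0, T] (derive_withinn `[0, T] j f) t,
      absolutely_continuous_on 0 T (derive_withinn `[0, T] n.-1 f),
      forall t : R, t \in `[0, T] -> `|f t| <= a
    & {ae lebesgue_measure, forall t : R, t \in `[0, T] ->
        derivable_within `[0, T] (derive_withinn `[0, T] n.-1 f) t /\
        `|derive_withinn `[0, T] n f t| <= b}].

Definition norm_infty {R : realType} (T : R) (g : R -> R) : \bar R :=
  'N[mrestr (@lebesgue_measure R) (measurable_itv `[0, T])]_+oo%E [EFin \o g].

(* Main.v *)
Require Import Defs.
From mathcomp Require Import lra ring measurable_realfun ess_sup_inf.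

(** An absolutely continuous g with |g'| <= b almost everywhere is b-Lipschitz:
    cover the exceptional null set by an open set U of small measure, advance
    from x to y by steps of slope at most b + e around the points outside U and
    by steps inside U around the other points; the latter form finitely many
    disjoint intervals of small total length, over which the absolute continuity
    makes the variation of g small. This applies to g = f^(n-1).

    On any segment of length L where |f| <= a, some point satisfies
    |f^(m)| <= 3^(m(m+1)) a / L^m: by induction on m there are such points for
    f^(m) in the first and the last third, and the mean value theorem between
    them gives one for f^(m+1).

    Comparing f^(k)(t) with its value at such a point costs at most
    T sup |f^(k+1)|, and a descending induction from k = n-1 concludes. *)

Set Implicit Arguments.
Unset Strict Implicit.
Unset Printing Implicit Defensive.

(** * Derivatives relative to a set and the mean value theorem *)

(** Clearing the denominator of the slope makes the estimate valid at [y = x] too. *)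
Lemma derivable_within_approx (R : realType) (A : set R) (f : R -> R)
    (x e : R) :
  derivable_within A f x -> 0 < e ->
  exists2 d : R, 0 < d & forall y, A y -> `|y - x| < d ->
    `|f y - f x - derive_within A f x * (y - x)| <= e * `|y - x|.
Proof.
rewrite /derivable_within => cf e0.
have {}cf : slope f x @ within A x^' --> derive_within A f x by exact: cf.
have /cvgrPdist_lt/(_ e e0) := cf.
rewrite /within /= /dnbhs /= => -[d d0 H].
exists d => // y Ay yx.
have [->|ynx] := eqVneq y x; first by rewrite !subrr mulr0 subrr normr0 mulr0.
have yx0 : y - x != 0 by rewrite subr_eq0.
have : `|derive_within A f x - slope f x y| < e.
  by apply: H => //; rewrite /ball/= distrC.
rewrite -[f y - f x](divfK yx0) -mulrBl normrM => Hlt.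
by rewrite ler_wpM2r// distrC ltW.
Qed.

(** Inside []u, v[] the derivative relative to [[c, d]] is the ordinary one, so the classical
    theorem applies. Keeping it relative to [[c, d]] lets iterated derivatives be used on
    subsegments. *)
Lemma MVT_within (R : realType) (c d : R) (f : R -> R) (u v : R) :
  (forall t, t \in `[c, d] -> derivable_within `[c, d] f t) ->
  c <= u -> u < v -> v <= d ->
  exists2 w, w \in `]u, v[ &
    f v - f u = derive_within `[c, d] f w * (v - u).
Proof.
move=> df cu uv vd.
have cdE t : u <= t -> t <= v -> t \in `[c, d].
  by move=> ut tv; rewrite in_itv/= (le_trans cu ut) (le_trans tv vd).
apply: MVT => // [x|].
  rewrite in_itv/= => /andP[ux xv].
  have xcd := cdE _ (ltW ux) (ltW xv).
  apply/is_derive1_caratheodory.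
  pose l := derive_within `[c, d] f x.
  exists (fun z => if z == x then l else slope f x z).
  split=> [z||]; last by rewrite eqxx.
    case: eqVneq => [->|zx]; first by rewrite !subrr mulr0.
    by rewrite /slope divfK// subr_eq0.
  apply/cvgrPdist_le => e e0 /=; rewrite eqxx.
  have [r r0 H] := derivable_within_approx (df _ xcd) e0.
  near=> z.
  case: eqVneq => [_|zx]; first by rewrite subrr normr0 ltW.
  have zx0 : z - x != 0 by rewrite subr_eq0.
  have := H z.
  have -> : f z - f x = slope f x z * (z - x) by rewrite /slope divfK.
  rewrite -mulrBl normrM ler_pM2r ?normr_gt0// => Hz.
  rewrite distrC; apply: Hz.
    apply: cdE; apply/ltW; near: z; [exact: lt_nbhsr|exact: lt_nbhsl].
  by rewrite distrC; near: z; exact: (nbhsx_ballx x r r0).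
apply/subspace_continuousP => x; rewrite /= in_itv/= => /andP[ux xv].
have xcd := cdE _ ux xv.
have [r r0 H] := derivable_within_approx (df _ xcd) ltr01.
set l := derive_within _ _ _ in H.
apply/cvgrPdist_le => e e0 /=.
(* With expansion error 1, the increment of [f] is at most [|l| + 1] times the distance from [y] to
   [x]. *)
have r'0 : 0 < Num.min r (e / (`|l| + 1)).
  by rewrite lt_min r0 divr_gt0// ltr_wpDl.
near=> y.
have ycd : y \in `[c, d].
  have : y \in `[u, v] by near: y; exact: withinT.
  by rewrite in_itv/= => /andP[]; exact: cdE.
have yx : `|y - x| < Num.min r (e / (`|l| + 1)).
  by rewrite distrC; near: y; apply: cvg_within; exact: (nbhsx_ballx x _ r'0).
move: yx; rewrite lt_min ltr_pdivlMr ?ltr_wpDl// => /andP[yr ye].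
rewrite distrC (le_trans _ (ltW ye))//.
rewrite -[f y - f x](subrK (l * (y - x))) (le_trans (ler_normD _ _))//.
rewrite normrM [leRHS]mulrDr mulr1 addrC.
by rewrite [`|l| * _]mulrC lerD2l -[leRHS]mul1r H.
Unshelve. all: by end_near. Qed.

(** * Lipschitz bounds from absolute continuity *)

(* The continuity method: the supremum of the points of [x, y] that satisfy P
   can be passed because P propagates across it. *)
Lemma real_creeping (R : realType) (P : R -> Prop) (x y : R) :
  x <= y -> P x ->
  (forall t, x <= t <= y -> exists2 r, 0 < r & forall s s',
    x <= s -> s <= t -> t <= s' -> s' <= y -> t - s < r -> s' - t < r ->
    P s -> P s') ->
  P y.
Proof.
move=> xy Px step.
pose S := [set s | [/\ x <= s, s <= y & P s]].
have Sx : S x by [].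
have ubS : ubound S y by move=> s [].
have supS : has_sup S by split; [exists x|exists y].
have xc : x <= sup S by apply: ub_le_sup => //; exists y.
have cy : sup S <= y by apply: ge_sup => //; exists x.
have [|r r0 H] := step (sup S); first by rewrite xc cy.
have [s [xs sy Ps] cs] := sup_adherent r0 supS.
have sc : s <= sup S by apply: ub_le_sup => //; exists y.
(* Either [y] is within reach of the step from [s], or that step passes beyond the supremum. *)
have [ylt|yge] := ltP y (sup S + r).
  by apply: (H s y) => //; lra.
have : sup S + r / 2 <= sup S.
  apply: ub_le_sup; first by exists y.
  split; [lra|lra|].
  by apply: (H s) => //; lra.
lra.
Qed.

(* The intervals ]u i, v i[ collect the steps of the continuity method that are
   centred at points of U; they come out sorted from left to right. *)
Lemma increment_le_off_open (R : realType) (h : R -> R) (U : set R)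
    (K x y : R) :
  open U -> 0 <= K -> x <= y ->
  (forall t, x <= t <= y -> ~ U t -> exists2 r, 0 < r & forall s,
    x <= s <= y -> `|s - t| < r -> `|h s - h t| <= K * `|s - t|) ->
  exists m (u v : nat -> R),
    [/\ forall i, (i < m)%N -> [/\ x <= u i, u i <= v i & v i <= y],
        forall i, (i < m)%N -> `]u i, v i[ `<=` U,
        forall i j, (i < j)%N -> (j < m)%N -> v i <= u j
      & `|h y - h x| <= K * (y - x) + \sum_(i < m) `|h (v i) - h (u i)|].
Proof.
move=> oU K0 xy loc.
pose P s := exists m (u v : nat -> R),
    [/\ forall i, (i < m)%N -> [/\ x <= u i, u i <= v i & v i <= s],
        forall i, (i < m)%N -> `]u i, v i[ `<=` U,
        forall i j, (i < j)%N -> (j < m)%N -> v i <= u j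
      & `|h s - h x| <= K * (s - x) + \sum_(i < m) `|h (v i) - h (u i)|].
have stepK s s' : s <= s' -> `|h s' - h s| <= K * (s' - s) -> P s -> P s'.
  move=> ss' hss' [m [u [v [H1 H2 H3 H4]]]]; exists m, u, v; split=> //.
    by move=> i /H1[xu uv vs]; split=> //; exact: le_trans ss'.
  have := ler_distD (h s) (h s') (h x); lra.
have stepU s s' : x <= s -> s <= s' ->
    `]s, s'[ `<=` U -> P s -> P s'.
  move=> xs ss' sU [m [u [v [H1 H2 H3 H4]]]].
  (* The new interval takes slot [m]; it lies to the right of the others, which end by [s]. *)
  exists m.+1, (fun i => if i == m then s else u i),
    (fun i => if i == m then s' else v i); split.
  - move=> i; rewrite ltnS leq_eqVlt; case: eqP => [_ _|_ /= /H1[xu uv vs]] //.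
    by split=> //; exact: le_trans ss'.
  - move=> i; rewrite ltnS leq_eqVlt; case: eqP => [_ _|_ /= /H2] //.
  - move=> i j ij; rewrite ltnS leq_eqVlt; case: eqP => [jm _|_ /= jm].
      have im : (i < m)%N by rewrite -jm.
      by rewrite ltn_eqF//; have [] := H1 _ im.
    by rewrite ltn_eqF ?(ltn_trans ij)// H3.
  - rewrite big_ord_recr/= eqxx.
    rewrite (eq_bigr (fun i : 'I_m => `|h (v i) - h (u i)|)); last first.
      by move=> i _; rewrite ltn_eqF.
    have : 0 <= K * (s' - s) by rewrite mulr_ge0// subr_ge0.
    have := ler_distD (h s) (h s') (h x); lra.
apply: (@real_creeping _ P x y xy).
  exists 0%N, (fun=> x), (fun=> x); split=> //.
  by rewrite !subrr normr0 mulr0 big_ord0 addr0.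
move=> t /andP[xt ty].
have [Ut|nUt] := pselect (U t).
  have /nbhs_ballP[r/= r0 tU] := open_nbhs_nbhs (conj oU Ut).
  exists r => // s s' xs st ts' s'y tsr s'tr.
  apply: stepU => //; first exact: le_trans ts'.
  move=> z; rewrite /= in_itv/= => /andP[sz zs'].
  by apply: tU; rewrite /ball/= ltr_distlC; apply/andP; split; lra.
have [|r r0 H] := loc t _ nUt; first by rewrite xt.
exists r => // s s' xs st ts' s'y tsr s'tr Ps.
(* The local bound only compares with [h t], so the step from [s] to [s'] is split at [t]. *)
apply: (stepK t) => //.
  rewrite -[s' - t]ger0_norm ?subr_ge0//.
  apply: H; last by rewrite ger0_norm ?subr_ge0.
  by rewrite (le_trans xs)// (le_trans st).
apply: (stepK s) => //.
rewrite distrC -[t - s]ger0_norm ?subr_ge0// [`|t - s|]distrC.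
apply: H; first by rewrite xs (le_trans st).
by rewrite distrC ger0_norm ?subr_ge0.
Qed.

Lemma ac_lipschitz (R : realType) (h : R -> R) (c d b : R) :
  0 <= b -> absolutely_continuous_on c d h ->
  {ae lebesgue_measure, forall t : R, t \in `[c, d] ->
     derivable_within `[c, d] h t /\ `|derive_within `[c, d] h t| <= b} ->
  forall x y, c <= x -> x <= y -> y <= d -> `|h y - h x| <= b * (y - x).
Proof.
move=> b0 ach [N [mN N0 subN]] x y cx xy yd; apply/ler_addgt0Pr => e e0.
(* The excess slope [e1] costs at most [e / 2] over [[x, y]]; the [+ 1] keeps the denominator
   nonzero when [x = y]. *)
pose e1 := e / (2 * (y - x + 1)).
have yx1 : 0 < y - x + 1 by rewrite ltr_wpDl// subr_ge0.
have e10 : 0 < e1 by rewrite divr_gt0// mulr_gt0.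
have [r r0 acr] := ach (e / 2) (divr_gt0 e0 (ltr0Sn R 1)).
have Noo : (lebesgue_measure N < +oo)%E by rewrite [X in (X < _)%E]N0.
have [U [oU NU Ur]] := lebesgue_regularity_outer mN Noo r0.
(* Regularity bounds only the measure of [U] minus [N]; as [N] is null, the bound passes to [U]. *)
have {}Ur : (lebesgue_measure U < r%:E)%E.
  rewrite -(setDUK NU) measureU//; last 2 first.
  - by apply: measurableD => //; exact: open_measurable.
  - by rewrite setDIK.
  by rewrite [X in (X + _ < _)%E]N0 add0e.
have [|| m [u [v [uv uvU uvS hyx]]]] :=
  @increment_le_off_open _ h U (b + e1) x y oU _ xy.
- by rewrite addr_ge0// ltW.
- move=> t /andP[xt ty] nUt.
  have [dt bt] : derivable_within `[c, d] h t /\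
      `|derive_within `[c, d] h t| <= b.
    apply: contrapT => H; apply: nUt; apply: NU; apply: subN => /= /(_ _)/H.
    by apply; rewrite in_itv/= (le_trans cx xt) (le_trans ty yd).
  have [s s0 H] := derivable_within_approx dt e10.
  exists s => // z /andP[xz zy] zt.
  have := H z _ zt; rewrite /= in_itv/= (le_trans cx xz) (le_trans zy yd).
  move=> /(_ isT) {}H.
  rewrite -(subrK (derive_within `[c, d] h t * (z - t)) (h z - h t)).
  rewrite (le_trans (ler_normD _ _))// addrC mulrDl lerD// normrM.
  exact: ler_wpM2r.
apply: (le_trans hyx).
have : (b + e1) * (y - x) <= b * (y - x) + e / 2.
  rewrite mulrDl lerD2l.
  have -> : e1 * (y - x) = e / 2 * ((y - x) / (y - x + 1)).
    by rewrite /e1; field; rewrite gt_eqF.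
  by rewrite ler_piMr ?divr_ge0 ?ltW// ltr_pdivrMr// mul1r ltrDl.
suff : \sum_(i < m) `|h (v i) - h (u i)| < e / 2 by lra.
have tuv : trivIset [set: 'I_m] (fun i : 'I_m => `]u i, v i[%classic).
  have lt_absurd (i j : nat) z : (i < j)%N -> (j < m)%N ->
      z \in `]u i, v i[ -> z \in `]u j, v j[ -> False.
    rewrite !in_itv/= => ij jm /andP[_ zv] /andP[uz _].
    by have := uvS i j ij jm; lra.
  move=> i j _ _ [z /= [zi zj]]; apply/val_inj => /=.
  have [ij|ij|//] := ltngtP i j.
    by exfalso; apply: (lt_absurd i j z).
  by exfalso; apply: (lt_absurd j i z).
apply: (acr m (fun i => u i) (fun i => v i)) => //.
  move=> i; have [xu uv' vy] := uv i (ltn_ord i).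
  by split; [lra|split=> //; lra].
rewrite -lte_fin; apply: le_lt_trans Ur.
have -> : ((\sum_(i < m) (v i - u i))%:E =
    \sum_(i < m) lebesgue_measure (`]u i, v i[ : set R))%E.
  rewrite -sumEFin; apply: eq_bigr => i _.
  have [_ uv' _] := uv i (ltn_ord i).
  rewrite lebesgue_measure_itv/= lte_fin.
  by case: ltP => // vu; rewrite (@le_anti _ _ (u i) (v i)) ?uv'// subrr.
rewrite -measure_bigsetU_ord//; apply: le_measure.
- by rewrite inE; apply: bigsetU_measurable.
- by rewrite inE; exact: open_measurable.
- rewrite -(bigcup_mkord m (fun i => `]u i, v i[%classic)).
  by apply: bigcup_sub => i; exact: uvU.
Qed.

(** * Bounds on the intermediate derivatives *)

Lemma exists_small_deriven (R : realType) (T : R) (f : R -> R) (m : nat) :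
  (forall j, (j < m)%N -> forall t : R, t \in `[0, T] ->
     derivable_within `[0, T] (derive_withinn `[0, T] j f) t) ->
  forall a c L : R, (forall t : R, t \in `[0, T] -> `|f t| <= a) ->
  0 <= c -> 0 < L -> c + L <= T ->
  exists2 x, c <= x <= c + L &
    `|derive_withinn `[0, T] m f x| <= (3 ^ (m * m.+1))%:R * a * L ^- m.
Proof.
elim: m => [|m IH] df a c L fa c0 L0 cLT.
  exists c; first by rewrite lexx lerDl ltW.
  by rewrite mul0n expn0 expr0 invr1 mulr1 mul1r fa// in_itv/= c0; lra.
have a0 : 0 <= a.
  by apply: (le_trans _ (fa c _)); rewrite ?in_itv/= ?c0//; lra.
have {}IH := IH (fun j jm => df j (ltnW jm)) a _ (L / 3) fa.
have L30 : 0 < L / 3 by lra.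
have cL1 : c + L / 3 <= T by lra.
have c20 : 0 <= c + 2 * (L / 3) by lra.
have cL2 : c + 2 * (L / 3) + L / 3 <= T by lra.
have [x1 /andP[cx1 x1c] fx1] := IH c c0 L30 cL1.
have [x2 /andP[cx2 x2c] fx2] := IH _ c20 L30 cL2.
have x12 : L / 3 <= x2 - x1 by lra.
have x10 : 0 <= x1 by lra.
have x1x2 : x1 < x2 by lra.
have x2T : x2 <= T by lra.
have [w] := MVT_within (df m (ltnSn m)) x10 x1x2 x2T.
rewrite in_itv/= => /andP[x1w wx2] wE.
exists w; first by apply/andP; split; lra.
set D := `|_|.
have DE : D * (x2 - x1) <= 2 * ((3 ^ (m * m.+1))%:R * a * (L / 3) ^- m).
  have x210 : 0 <= x2 - x1 by rewrite subr_ge0 ltW.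
  rewrite -(ger0_norm x210).
  rewrite /D -normrM -wE (le_trans (ler_normB _ _))//.
  by rewrite mulr2n mulrDl !mul1r addrC lerD.
have {}DE : D * (L / 3) <= 2 * ((3 ^ (m * m.+1))%:R * a * (L / 3) ^- m).
  by apply: le_trans DE; rewrite ler_wpM2l ?normr_ge0.
move: DE; rewrite -ler_pdivlMr// => /le_trans; apply.
have -> : 2 * ((3 ^ (m * m.+1))%:R * a * (L / 3) ^- m) / (L / 3) =
  2 * 3 ^+ m.+1 * (3 ^ (m * m.+1))%:R * (a * L ^- m.+1) :> R.
  rewrite exprMn exprVn !exprS; field.
  by rewrite !gt_eqF// exprn_gt0.
rewrite -[leRHS]mulrA ler_wpM2r//.
  by rewrite mulr_ge0// invr_ge0 exprn_ge0// ltW.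
(* The exponent of 3 absorbs the factor [2 * 3 ^ m.+1], which is at most [3 ^ m.+1] squared, since
   [m (m + 1) + 2 (m + 1) = (m + 1) (m + 2)]. *)
have -> : (3 ^ (m.+1 * m.+2))%:R =
  3 ^+ m.+1 * 3 ^+ m.+1 * (3 ^ (m * m.+1))%:R :> R.
  by rewrite !natrX -!exprD; congr (_ ^+ _); ring.
rewrite ler_wpM2r// ler_wpM2r ?exprn_ge0// exprS -[leLHS]mulr1 ler_pM//.
  by rewrite ler_nat.
by rewrite exprn_ege1// ler1n.
Qed.

(** Here [n] is the order of the Lipschitz derivative, one less than the order in [class_L], hence
    the exponent [n.+1 - k]. Each order met in the descent from [n] to [k] contributes one term to
    the sum. *)
Lemma deriven_le_of_lipschitz (R : realType) (T a b : R) (f : R -> R)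
    (n k : nat) :
  0 < T -> 0 <= b ->
  (forall j, (j < n)%N -> forall t : R, t \in `[0, T] ->
     derivable_within `[0, T] (derive_withinn `[0, T] j f) t) ->
  (forall x y : R, 0 <= x -> x <= y -> y <= T ->
     `|derive_withinn `[0, T] n f y - derive_withinn `[0, T] n f x|
       <= b * (y - x)) ->
  (forall t : R, t \in `[0, T] -> `|f t| <= a) ->
  (k <= n)%N ->
  forall t : R, t \in `[0, T] -> `|derive_withinn `[0, T] k f t| <=
    (\sum_(k <= j < n.+1) (3 ^ (j * j.+1))%:R) * a * T ^- k
      + b * T ^+ (n.+1 - k).
Proof.
move=> T0 b0 df lip fa kn.
have key k' M : (k' <= n)%N -> 0 <= M ->
    (forall x y : R, 0 <= x -> x <= y -> y <= T ->
     `|derive_withinn `[0, T] k' f y - derive_withinn `[0, T] k' f x|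
       <= M * (y - x)) ->
    forall t : R, t \in `[0, T] -> `|derive_withinn `[0, T] k' f t| <=
      (3 ^ (k' * k'.+1))%:R * a * T ^- k' + M * T.
  move=> k'n M0 lipM t; rewrite in_itv/= => /andP[t0 tT].
  have dfk j (jk : (j < k')%N) := df j (leq_trans jk k'n).
  have T0T : 0 + T <= T by rewrite add0r.
  have [x /andP[x0 xT] fx] := exists_small_deriven dfk fa (lexx 0) T0 T0T.
  rewrite add0r in xT.
  have ftx : `|derive_withinn `[0, T] k' f t - derive_withinn `[0, T] k' f x|
      <= M * T.
    have [tx|/ltW xt] := leP x t.
      by apply: (le_trans (lipM _ _ _ _ _)) => //; rewrite ler_wpM2l//; lra.
    rewrite distrC.
    by apply: (le_trans (lipM _ _ _ _ _)) => //; rewrite ler_wpM2l//; lra.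
  rewrite -(subrK (derive_withinn `[0, T] k' f x) (derive_withinn _ _ _ t)).
  by rewrite (le_trans (ler_normD _ _))// addrC lerD.
have [i kin] : exists i, (k + i = n)%N by exists (n - k)%N; rewrite subnKC.
elim: i k kin {kn} => [|i IH] k kin t tT.
  rewrite addn0 in kin; rewrite kin big_nat1 subSnn expr1.
  exact: key.
have kn : (k < n)%N by rewrite -kin -addSnnS leq_addr.
have {}IH := IH k.+1 (etrans (addSnnS _ _) kin).
(* By the mean value theorem, the bound for order [k.+1] is a Lipschitz constant for order [k]. *)
pose M := (\sum_(k.+1 <= j < n.+1) (3 ^ (j * j.+1))%:R) * a * T ^- k.+1
  + b * T ^+ (n.+1 - k.+1).
have M0 : 0 <= M by apply: le_trans (IH t tT).
apply: (le_trans (key k M _ M0 _ t tT)); first exact: ltnW.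
  move=> x y x0; rewrite le_eqVlt => /predU1P[<-|xy] yT.
    by rewrite !subrr normr0 mulr0.
  have [w] := MVT_within (df k kn) x0 xy yT.
  rewrite in_itv/= => /andP[xw wy] ->.
  rewrite normrM [`|y - x|]ger0_norm ?subr_ge0 ?(ltW xy)// ler_wpM2r//.
    by rewrite subr_ge0 ltW.
  by apply: IH; rewrite in_itv/=; apply/andP; split; lra.
(* The factor [T] in [M * T] raises both powers of [T] by one, and [key] supplies the summand
   [j = k], so the two sides are equal. *)
rewrite (@big_ltn _ _ _ k) ?ltnS ?(ltnW kn)// /M.
rewrite [in leRHS]subSn ?(ltnW kn)// subSS [T ^+ k.+1]exprS
  [T ^+ (n - k).+1]exprS invfM.
set S := \sum_(_ <= _ < _) _.
rewrite le_eqVlt; apply/orP; left; apply/eqP; field.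
by rewrite !gt_eqF// exprn_gt0.
Qed.

(** * The constants and the passage to the essential supremum *)

Theorem proposition6 (R : realType) (n k : nat) (hn : (2 <= n)%N)
    (hk0 : (0 < k)%N) (hkn : (k < n)%N) :
  exists A B : R, 0 < A /\ 0 < B /\
    forall (T a b : R) (f : R -> R), 0 < T -> 0 < a -> 0 < b ->
      class_L n a b T f ->
      (norm_infty T (derive_withinn `[0%R, T]%classic k f)
        <= (A * a * T ^- k + B * b * T ^+ (n - k))%:E)%E.
Proof.
case: n hn hkn => // n hn hkn.
(* The case split replaced [n] by its predecessor, so the sum ends at the order of the Lipschitz
   derivative. *)
exists (\sum_(k <= j < n.+1) (3 ^ (j * j.+1))%:R), 1; split.
  by rewrite big_ltn// ltr_pwDl ?sumr_ge0// ltr0n expn_gt0.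
split=> // T a b f T0 a0 b0 [df ac fa aeb].
have lip := ac_lipschitz (ltW b0) ac aeb.
have bound := deriven_le_of_lipschitz T0 (ltW b0) df lip fa hkn.
rewrite mul1r; set C := (X in X%:E).
have C0 : 0 <= C.
  apply: le_trans (bound 0 _); rewrite ?normr_ge0 ?in_itv/= ?lexx ?ltW//.
(* The norm defaults to 0 on a space of measure zero; [C0] settles that branch. *)
rewrite /norm_infty unlock; case: ifPn => [_|_]; last by rewrite lee_fin.
(* The complement of [[0, T]] is null for the restricted measure, and the bound holds at every other
   point. *)
apply/ess_supP; exists (~` `[0, T]%classic); split.
- exact: measurableC.
- rewrite [LHS](_ : _ = lebesgue_measure (~` `[0, T] `&` `[0, T] : set R))//.
  by rewrite setICl measure0.
- by move=> t /= Ht tT; apply: Ht; rewrite lee_fin; apply: bound.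
Qed.
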